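(* Let $k\ge 0$ be an integer and let $n_0,n_1,\dots,n_{k+1}\ge 1$ be integers. Let $f_{in}$ be a cycle layer with $n_0$ output groups, let $f_{hide}^{(i)}$ ($1\le i\le k$) be an isotonic layer taking $n_{i-1}$ groups to $n_i$ groups (different isotonic layers may have different weights), and let $f_{out}$ be a decycle layer taking $n_k$ groups to $n_{k+1}$ feature maps. Then the composition $$f=f_{out}\circ f_{hide}^{(k)}\circ\cdots\circ f_{hide}^{(1)}\circ f_{in}$$ is rotation equivariant: for every input image $x$, $$f(\mathcal{R}x)=\mathcal{R}f(x),$$ where $\mathcal{R}$ denotes counterclockwise rotation by $\pi/2$. In particular this holds when $n_i=1$ for all $0\le i\le k+1$.
   Context: Images and feature maps are two-dimensional arrays of real numbers, and filters are square arrays of real numbers. $\mathcal{R}$ rotates an array by $\pi/2$ counterclockwise. $w*x$ denotes the stride-1 two-dimensional convolution, as used in convolutional neural networks, of a filter $w$ with an image or feature map $x$. A hyper-matrix (hyper-vector) is a matrix (vector) whose entries are filters or feature maps. For an $m\times n$ hyper-matrix $W$ of filters and a hyper-vector $x=(x_1,\dots,x_n)$ of feature maps, $W*x$ is the hyper-vector of length $m$ with $i$-th entry $\sum_{j=1}^n W_{ij}*x_j$. $\mathcal{R}$ acts on hyper-matrices and hyper-vectors entrywise, and addition is entrywise. The following basic facts are taken as given for these operations: $\mathcal{R}(W*x)=\mathcal{R}(W)*\mathcal{R}(x)$; $\mathcal{R}(X_1+X_2)=\mathcal{R}(X_1)+\mathcal{R}(X_2)$; and $\mathcal{R}^4$ is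 the identity. Layers consist of convolution only (no bias, activation function or other structure), and sizes are such that all the operations are defined. A group is a hyper-vector consisting of 4 feature maps; a collection of $n$ groups is regarded as a hyper-vector of length $4n$, group after group. Cycle layer with $n_0$ groups: $f_{in}(x)=W_{in}*x$ for a single image $x$, where $W_{in}$ is a column hyper-vector of length $4n_0$ obtained by stacking $n_0$ blocks, each of the form $[w,\mathcal{R}w,\mathcal{R}^2w,\mathcal{R}^3w]^T$ for some filter $w$ (depending on the block). Isotonic layer from $n$ groups to $m$ groups: $f_{hide}(x)=W_{hide}*x$ for a hyper-vector $x$ of length $4n$, where $W_{hide}$ is a $4m\times 4n$ hyper-matrix made of $m\times n$ blocks, each a $4\times 4$ hyper-matrix of the form $$\begin{pmatrix}A&B&C&D\\ \mathcal{R}D&\mathcal{R}A&\mathcal{R}B&\mathcal{R}C\\ \mathcal{R}^2C&\mathcal{R}^2D&\mathcal{R}^2A&\mathcal{R}^2B\\ \mathcal{R}^3B&\mathcal{R}^3C&\mathcal{R}^3D&\mathcal{R}^3A\end{pmatrix}$$ for some square filters $A,B,C,D$ of the same size (depending on the block). Decycle layer from $n$ groups to $m$ feature maps: $f_{out}(x)=W_{out}*x$ for a hyper-vector $x$ of length $4n$, where $W_{out}$ is an $m\times 4n$ hyper-matrix made of $m\times n$ blocks, each a row ($1\times 4$) of the form $[w,\mathcal{R}w,\mathcal{R}^2w,\mathcal{R}^3w]$ for some filter $w$ (depending on the block). *)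

(* Defs.v *)
From HB Require Import structures.
From mathcomp Require Import all_boot all_order all_algebra.
From mathcomp Require Import reals.

Set Implicit Arguments.
Unset Strict Implicit.
Unset Printing Implicit Defensive.

Import GRing.Theory.
Local Open Scope ring_scope.

(* A two-dimensional array of arbitrary size. Sizes are data rather than
   indices, since feature maps and filters of different sizes may occur in the
   same hyper-vector or hyper-matrix, and a network applies to images of any
   size (rotating a non-square image exchanges its dimensions). *)
Record array (R : Type) := Array {
  height : nat;
  width : nat;
  pixels :> 'M[R]_(height, width)
}.
Arguments Array {R height width} pixels.

(* Row 0 is the top row and column 0 the leftmost one, so that a
   counterclockwise quarter turn sends the last column to the first row. *)
Definition rotmx (R : Type) (h w : nat) (x : 'M[R]_(h, w)) : 'M[R]_(w, h) :=
  \matrix_(i < w, j < h) x j (rev_ord i).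

Definition rot90 (R : Type) (x : array R) : array R := Array (rotmx (pixels x)).

Lemma shift_ord_subproof (h s : nat) (i : 'I_(h.+1 - s)) (a : 'I_s) :
  (i + a < h)%N.
Proof.
have := ltn_ord i; rewrite ltn_subRL addnC ltnS => le_is_h.
by apply: leq_trans le_is_h; rewrite ltn_add2l.
Qed.

Definition shift_ord (h s : nat) (i : 'I_(h.+1 - s)) (a : 'I_s) : 'I_h :=
  Ordinal (shift_ord_subproof i a).

(* The sliding inner product without reflection of the filter, which is what
   neural networks call convolution. *)
Definition convmx (R : nzRingType) (s t h w : nat)
    (f : 'M[R]_(s, t)) (x : 'M[R]_(h, w)) : 'M[R]_(h.+1 - s, w.+1 - t) :=
  \matrix_(i, j) \sum_(a < s) \sum_(b < t) f a b * x (shift_ord i a) (shift_ord j b).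

(* p rows of zeros above and below, q columns of zeros left and right. *)
Definition zero_pad (R : nzRingType) (p q h w : nat) (x : 'M[R]_(h, w)) :
    'M[R]_(p + (h + p), q + (w + q)) :=
  block_mx 0 0 0 (block_mx x 0 0 0).

(* Operations on arrays are defined only for compatible sizes; None stands for
   an undefined result and is propagated by every operation. *)
Notation feature_map R := (option (array R)).

(* pad gives the amount of zero padding as a function of the filter size:
   fun=> 0 is convolution without padding, half is the size-preserving one for
   filters of odd size. *)
Definition conv (R : nzRingType) (pad : nat -> nat) (f x : array R) :
    feature_map R :=
  let px := Array (zero_pad (pad (height f)) (pad (width f)) (pixels x)) in
  if (height f <= height px)%N && (width f <= width px)%N
  then Some (Array (convmx (pixels f) (pixels px))) else None.

Definition add_array (R : nzRingType) (x y : array R) : feature_map R :=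
  if (height x == height y) && (width x == width y)
  then Some (Array (pixels x + conform_mx 0 (pixels y))) else None.

(* There is no empty sum, as it would have no size. *)
Fixpoint sum_maps (R : nzRingType) (s : seq (feature_map R)) : feature_map R :=
  match s with
  | [::] => None
  | [:: a] => a
  | a :: s' => obind (fun x => obind (add_array x) (sum_maps s')) a
  end.

Definition hyper_conv (R : nzRingType) (pad : nat -> nat) (m n : nat)
    (W : 'M[array R]_(m, n)) (x : 'cV[feature_map R]_n) : 'cV[feature_map R]_m :=
  \col_i sum_maps [seq obind (conv pad (W i j)) (x j 0) | j <- enum 'I_n].

Definition hyper_rot (R : Type) (n : nat) (x : 'cV[feature_map R]_n) :
    'cV[feature_map R]_n :=
  map_mx (omap (@rot90 R)) x.

Lemma group_index_subproof (n : nat) (g : 'I_n) (r : 'I_4) :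
  (4 * g + r < 4 * n)%N.
Proof.
apply: (@leq_trans (4 * g.+1)); last by rewrite leq_mul2l ltn_ord.
by rewrite mulnS addnC ltn_add2r.
Qed.

(* The position of the r-th entry of group g when groups are concatenated. *)
Definition group_index (n : nat) (g : 'I_n) (r : 'I_4) : 'I_(4 * n) :=
  Ordinal (group_index_subproof g r).

Definition cycle_layer (R : Type) (n : nat) (W : 'M[array R]_(4 * n, 1)) : Prop :=
  forall g : 'I_n, exists (s : nat) (w : 'M[R]_s),
    \col_(r < 4) W (group_index g r) 0 = \col_(r < 4) iter r (@rot90 R) (Array w).

Definition isotonic_block (R : Type) (A B C D : array R) : 'M[array R]_4 :=
  let rot1 := @rot90 R in
  let rot2 x := rot1 (rot1 x) in
  let rot3 x := rot1 (rot2 x) in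
  \matrix_(i, j) nth A (nth [::]
    [:: [::      A;      B;      C;      D];
        [:: rot1 D; rot1 A; rot1 B; rot1 C];
        [:: rot2 C; rot2 D; rot2 A; rot2 B];
        [:: rot3 B; rot3 C; rot3 D; rot3 A]] i) j.

Definition isotonic_layer (R : Type) (n m : nat)
    (W : 'M[array R]_(4 * m, 4 * n)) : Prop :=
  forall (p : 'I_m) (q : 'I_n), exists (s : nat) (A B C D : 'M[R]_s),
    \matrix_(r < 4, c < 4) W (group_index p r) (group_index q c)
    = isotonic_block (Array A) (Array B) (Array C) (Array D).

Definition decycle_layer (R : Type) (n m : nat) (W : 'M[array R]_(m, 4 * n)) :
    Prop :=
  forall (p : 'I_m) (q : 'I_n), exists (s : nat) (w : 'M[R]_s),
    \row_(c < 4) W p (group_index q c) = \row_(c < 4) iter c (@rot90 R) (Array w).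

(* Whide i is the matrix of the hidden layer number i + 1. *)
Fixpoint hidden_layers (R : nzRingType) (pad : nat -> nat) (n : nat -> nat)
    (Whide : forall i, 'M[array R]_(4 * n i.+1, 4 * n i)) (k : nat)
    (x : 'cV[feature_map R]_(4 * n 0%N)) : 'cV[feature_map R]_(4 * n k) :=
  match k with
  | 0 => x
  | k'.+1 => hyper_conv pad (Whide k') (hidden_layers pad Whide k' x)
  end.

Definition network (R : nzRingType) (pad : nat -> nat) (k : nat) (n : nat -> nat)
    (Win : 'M[array R]_(4 * n 0%N, 1))
    (Whide : forall i, 'M[array R]_(4 * n i.+1, 4 * n i))
    (Wout : 'M[array R]_(n k.+1, 4 * n k))
    (x : array R) : 'cV[feature_map R]_(n k.+1) :=
  hyper_conv pad Wout
    (hidden_layers pad Whide k (hyper_conv pad Win (const_mx (Some x)))).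

(* Main.v *)
Require Import Defs.
From mathcomp Require Import all_boot all_order all_algebra.
From mathcomp Require Import reals.
From mathcomp Require Import zify.

Set Implicit Arguments.
Unset Strict Implicit.
Unset Printing Implicit Defensive.

Local Open Scope ring_scope.

(* Let sigma shift each group cyclically, entry r going to entry r + 1 mod 4.
   Since R^4 = 1, all three kinds of layers satisfy W (sigma i) (sigma j) =
   R (W i j), where sigma is replaced by the identity on the input of the cycle
   layer and on the output of the decycle layer.  As R commutes with convolution
   and sums may be reindexed along sigma, such a layer turns the relation
   x' (sigma j) = R (x j) between hyper-vectors into the same relation between
   their images; on the input and on the output it reads x' = R x. *)

Lemma rot90_4 (R : Type) (x : array R) : rot90 (rot90 (rot90 (rot90 x))) = x.
Proof.
case: x => h w x; congr Array.
by apply/matrixP => i j; rewrite !mxE !rev_ordK.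
Qed.

Lemma rotmxD (R : nzRingType) (h w : nat) (x y : 'M[R]_(h, w)) :
  rotmx (x + y) = rotmx x + rotmx y.
Proof. by apply/matrixP => i j; rewrite !mxE. Qed.

(** Together with [zero_pad_out], this replaces the nested blocks of [zero_pad] by arithmetic
    conditions on indices, within reach of [lia]. *)
Lemma zero_pad_in (R : nzRingType) (p q h w : nat) (x : 'M[R]_(h, w))
    (i' : 'I_h) (j' : 'I_w) (i : 'I_(p + (h + p))) (j : 'I_(q + (w + q))) :
  i = (p + i')%N :> nat -> j = (q + j')%N :> nat -> zero_pad p q x i j = x i' j'.
Proof.
move=> ei ej; have -> : i = rshift p (lshift p i') by exact: val_inj.
have -> : j = rshift q (lshift q j') by exact: val_inj.
by rewrite /zero_pad block_mxEdr block_mxEul.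
Qed.

Lemma zero_pad_out (R : nzRingType) (p q h w : nat) (x : 'M[R]_(h, w))
    (i : 'I_(p + (h + p))) (j : 'I_(q + (w + q))) :
  ~~ [&& p <= i, i < p + h, q <= j & j < q + w]%N -> zero_pad p q x i j = 0.
Proof.
move=> out; rewrite /zero_pad.
case: (split_ordP i) out => i' ->; case: (split_ordP j) => j' -> out;
  rewrite ?(block_mxEul, block_mxEur, block_mxEdl) ?[const_mx _ _ _]mxE //.
rewrite block_mxEdr; case: (split_ordP i') out => i2 ->; case: (split_ordP j') => j2 -> out;
  rewrite ?(block_mxEur, block_mxEdl, block_mxEdr) ?[const_mx _ _ _]mxE //.
(* Only the block that holds [x] is left, and its indices contradict [out]. *)
by move: out => /=; have := ltn_ord i2; have := ltn_ord j2; lia.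
Qed.

(** Opposite sides carry equally many zeros, so reversing an index preserves the frame; inside it,
    [(q + w + q) - 1 - i = q + (w - 1 - (i - q))]. *)
Lemma rotmx_zero_pad (R : nzRingType) (p q h w : nat) (x : 'M[R]_(h, w)) :
  rotmx (zero_pad p q x) = zero_pad q p (rotmx x).
Proof.
apply/matrixP => i j; rewrite mxE.
have [/and4P[qi iw pj jh]|out] :=
  boolP [&& q <= i, i < q + w, p <= j & j < p + h]%N; last first.
  rewrite !zero_pad_out //=.
  by move: out; have := ltn_ord i; lia.
have lt_i : (i - q < w)%N by lia.
have lt_j : (j - p < h)%N by lia.
rewrite (@zero_pad_in _ _ _ _ _ (rotmx x) (Ordinal lt_i) (Ordinal lt_j)) /=;
  try lia.
rewrite [RHS]mxE (@zero_pad_in _ _ _ _ _ _ (Ordinal lt_j) (rev_ord (Ordinal lt_i))) //=;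
  lia.
Qed.

Lemma rotmx_conv (R : nzRingType) (s t h w : nat)
    (f : 'M[R]_(s, t)) (x : 'M[R]_(h, w)) :
  rotmx (convmx f x) = convmx (rotmx f) (rotmx x).
Proof.
apply/matrixP => i j; rewrite !mxE exchange_big /=.
(* Reversing both the window position and the offset reverses the column read: [(w - t - i) + (t - 1
   - b) = w - 1 - (i + b)]. *)
rewrite (reindex_inj rev_ord_inj) /=; apply: eq_bigr => b _.
apply: eq_bigr => a _; rewrite !mxE; congr (_ * x _ _); apply: val_inj => /=.
by have := ltn_ord i; have := ltn_ord b; lia.
Qed.

Lemma rot90_conv (R : nzRingType) (pad : nat -> nat) (f x : array R) :
  conv pad (rot90 f) (rot90 x) = omap (@rot90 R) (conv pad f x).
Proof.
(* Rotating the filter exchanges its dimensions, hence the two padding amounts and the two size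
   tests. *)
rewrite /conv /= -rotmx_zero_pad andbC.
by case: ifP => //= _; rewrite /rot90 /= rotmx_conv.
Qed.

Lemma rot90_add_array (R : nzRingType) (x y : array R) :
  add_array (rot90 x) (rot90 y) = omap (@rot90 R) (add_array x y).
Proof.
case: x y => [h w x] [h' w' y]; rewrite /add_array /= andbC.
case: andP => //= -[/eqP eh /eqP ew]; subst h' w'.
by rewrite /rot90 /= !conform_mx_id rotmxD.
Qed.

(** The binary step of [sum_maps], isolated so that its algebraic laws can be stated. *)
Definition add_maps (R : nzRingType) (a b : feature_map R) : feature_map R :=
  obind (fun x => obind (add_array x) b) a.

Lemma add_mapsC (R : nzRingType) : commutative (@add_maps R).
Proof.
move=> [[h w x]|] [[h' w' y]|] //=; rewrite /add_array /=.
rewrite (eq_sym h') (eq_sym w').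
case: andP => //= -[/eqP eh /eqP ew]; subst h' w'.
by rewrite !conform_mx_id GRing.addrC.
Qed.

(** For three defined maps, either bracketing is defined exactly when all three sizes agree. *)
Lemma add_mapsA (R : nzRingType) : associative (@add_maps R).
Proof.
move=> [[h w x]|] [[h' w' y]|] [[h'' w'' z]|] //=; rewrite /add_array /=;
  last by case: ifP.
have [/andP[/eqP eh /eqP ew]|] := boolP ((h == h') && (w == w')); last first.
  by move=> /negbTE ne; case: ifP => //=; rewrite /add_array /= ne.
subst h' w' => /=.
case: ifP => //= [/andP[/eqP eh /eqP ew]|ne].
  by subst h'' w''; rewrite /add_array /= !eqxx /= !conform_mx_id GRing.addrA.
by rewrite /add_array /= ne.
Qed.

(** This gives access to reindexing of big operators. Since a zero array has a size, [add_maps] has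
    no neutral element; [oAC] adjoins one, the outer [None], distinct from the inner [None] of an
    undefined map. Only the empty sum yields the outer one, and [odflt] sends it to the undefined
    map. *)
Lemma sum_mapsE (R : nzRingType) (I : Type) (s : seq I) (F : I -> feature_map R) :
  sum_maps [seq F i | i <- s] =
  odflt None (\big[oAC (@add_mapsA R) (@add_mapsC R)/None]_(i <- s) Some (F i)).
Proof.
suff sumE i t : \big[oAC (@add_mapsA R) (@add_mapsC R)/None]_(j <- i :: t)
                  Some (F j) = Some (sum_maps [seq F j | j <- i :: t]).
  by case: s => [|i s]; rewrite ?big_nil ?sumE.
by elim: t i => [|j t IHt] i; rewrite big_cons ?big_nil // IHt oACE.
Qed.

Lemma omap_rot90_add_maps (R : nzRingType) (a b : feature_map R) :
  omap (@rot90 R) (add_maps a b) =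
  add_maps (omap (@rot90 R) a) (omap (@rot90 R) b).
Proof. by case: a b => [x|] [y|] //=; rewrite rot90_add_array. Qed.

Lemma rot90_sum_maps (R : nzRingType) (s : seq (feature_map R)) :
  omap (@rot90 R) (sum_maps s) = sum_maps (map (omap (@rot90 R)) s).
Proof.
elim: s => [|a [|b s] IHs] //.
by rewrite [LHS]omap_rot90_add_maps IHs.
Qed.

Lemma hyper_conv_equivariant (R : nzRingType) (pad : nat -> nat) (m n : nat)
    (sigma : 'I_m -> 'I_m) (tau : 'I_n -> 'I_n) (W : 'M[array R]_(m, n))
    (x x' : 'cV[feature_map R]_n) :
  injective tau ->
  (forall i j, W (sigma i) (tau j) = rot90 (W i j)) ->
  (forall j, x' (tau j) 0 = omap (@rot90 R) (x j 0)) ->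
  forall i, hyper_conv pad W x' (sigma i) 0 =
            omap (@rot90 R) (hyper_conv pad W x i 0).
Proof.
move=> tau_inj W_tau x_tau i; rewrite !mxE rot90_sum_maps -map_comp !sum_mapsE.
rewrite !big_enum (reindex_inj tau_inj) /=; congr odflt.
apply: eq_bigr => j _; congr Some; rewrite W_tau x_tau.
by case: (x j 0) => //= y; rewrite rot90_conv.
Qed.

Lemma group_indexP (n : nat) (i : 'I_(4 * n)) :
  exists (g : 'I_n) (r : 'I_4), i = group_index g r.
Proof.
have lt_g : (i %/ 4 < n)%N by have := ltn_ord i; lia.
have lt_r : (i %% 4 < 4)%N by rewrite ltn_mod.
exists (Ordinal lt_g), (Ordinal lt_r); apply: val_inj => /=.
by lia.
Qed.

Lemma group_shift_subproof (n : nat) (i : 'I_(4 * n)) :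
  (4 * (i %/ 4) + (i %% 4).+1 %% 4 < 4 * n)%N.
Proof. by have := ltn_ord i; lia. Qed.

(** The map sigma: the quotient by 4 is the group, the remainder the position in it. *)
Definition group_shift (n : nat) (i : 'I_(4 * n)) : 'I_(4 * n) :=
  Ordinal (group_shift_subproof i).

Lemma group_shift_index (n : nat) (g : 'I_n) (r : 'I_4) :
  group_shift (group_index g r) = group_index g (ordS r).
Proof. by apply: val_inj => /=; have := ltn_ord r; lia. Qed.

Lemma group_shift_inj (n : nat) : injective (@group_shift n).
Proof. by move=> i j /(congr1 val) /= e; apply: val_inj => /=; lia. Qed.

(** Only the wrap-around from [r = 3] to [0] uses that four quarter turns cancel. *)
Lemma iter_ordS_rot90 (R : Type) (r : 'I_4) (x : array R) :
  iter (ordS r) (@rot90 R) x = rot90 (iter r (@rot90 R) x).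
Proof. by case: r => [[|[|[|[|]]]]] //= _; rewrite rot90_4. Qed.

Lemma cycle_layer_shift (R : Type) (n : nat) (W : 'M[array R]_(4 * n, 1)) :
  cycle_layer W -> forall i j, W (group_shift i) j = rot90 (W i j).
Proof.
move=> cycW i j; have [g [r ->]] := group_indexP i; rewrite group_shift_index.
have [s [w /colP eW]] := cycW g; rewrite (ord1 j).
by have := eW r; have := eW (ordS r); rewrite !mxE => -> ->; rewrite iter_ordS_rot90.
Qed.

Lemma decycle_layer_shift (R : Type) (n m : nat) (W : 'M[array R]_(m, 4 * n)) :
  decycle_layer W -> forall i j, W i (group_shift j) = rot90 (W i j).
Proof.
move=> decW i j; have [g [r ->]] := group_indexP j; rewrite group_shift_index.
have [s [w /rowP eW]] := decW i g.
by have := eW r; have := eW (ordS r); rewrite !mxE => -> ->; rewrite iter_ordS_rot90.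
Qed.

(** Entry [(r, c)] is the [r]-th rotation of the filter numbered [c - r] mod 4 in [A, B, C, D];
    shifting both indices keeps that filter and adds one rotation. *)
Lemma isotonic_block_shift (R : Type) (A B C D : array R) (r c : 'I_4) :
  isotonic_block A B C D (ordS r) (ordS c) = rot90 (isotonic_block A B C D r c).
Proof.
rewrite !mxE; case: r c => [[|[|[|[|]]]]] // _ [[|[|[|[|]]]]] //= _;
  by rewrite rot90_4.
Qed.

Lemma isotonic_layer_shift (R : Type) (n m : nat)
    (W : 'M[array R]_(4 * m, 4 * n)) :
  isotonic_layer W ->
  forall i j, W (group_shift i) (group_shift j) = rot90 (W i j).
Proof.
move=> isoW i j; have [p [r ->]] := group_indexP i.
have [q [c ->]] := group_indexP j; rewrite !group_shift_index.
have [s [A [B [C [D /matrixP eW]]]]] := isoW p q.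
have := eW r c; have := eW (ordS r) (ordS c).
by rewrite !isotonic_block_shift mxE [X in _ -> X = _ -> _]mxE => -> ->.
Qed.

Lemma hidden_layers_shift (R : nzRingType) (pad : nat -> nat) (n : nat -> nat)
    (Whide : forall i, 'M[array R]_(4 * n i.+1, 4 * n i)) (k : nat)
    (x x' : 'cV[feature_map R]_(4 * n 0%N)) :
  (forall i, (i < k)%N -> isotonic_layer (Whide i)) ->
  (forall j, x' (group_shift j) 0 = omap (@rot90 R) (x j 0)) ->
  forall j, hidden_layers pad Whide k x' (group_shift j) 0 =
            omap (@rot90 R) (hidden_layers pad Whide k x j 0).
Proof.
move=> isoW x_shift; elim: k isoW => [|k IHk] isoW //=.
apply: hyper_conv_equivariant; first exact: group_shift_inj.
  exact: isotonic_layer_shift (isoW k _).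
by apply: IHk => i lt_ik; apply: isoW; apply: ltnW.
Qed.

Theorem mainTheorem1 (R : realType) (pad : nat -> nat) (k : nat) (n : nat -> nat)
    (n_ge1 : forall i : nat, (i <= k.+1)%N -> (1 <= n i)%N)
    (Win : 'M[array R]_(4 * n 0%N, 1))
    (Whide : forall i : nat, 'M[array R]_(4 * n i.+1, 4 * n i))
    (Wout : 'M[array R]_(n k.+1, 4 * n k))
    (cycle_in : cycle_layer Win)
    (isotonic_hide : forall i : nat, (i < k)%N -> isotonic_layer (Whide i))
    (decycle_out : decycle_layer Wout)
    (x : array R) :
  network pad Win Whide Wout (rot90 x) = hyper_rot (network pad Win Whide Wout x).
Proof.
apply/colP => i; rewrite [RHS]mxE /network.
(* Layers are peeled off from the output inwards, down to the one-entry input, where the relation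
   holds by definition. *)
apply: (hyper_conv_equivariant pad (sigma := id) (@group_shift_inj _)).
  exact: decycle_layer_shift.
apply: hidden_layers_shift => //.
apply: (hyper_conv_equivariant pad (tau := id)) => //.
  exact: cycle_layer_shift.
by move=> j; rewrite !mxE.
Qed.
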